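(* Let $f$ be a field of characteristic $0$, $f^\ast=f\setminus\{0\}$, $\lambda,\mu\in f$, and let $m\ge 0$ be an integer. Consider the natural action of the Lie algebra $L_{m+1}$ and of the group $G_{m+1}$ on $F_{\lambda\mu}=f[[t]]\,t^\mu(dt)^{-\lambda}$ with topological basis $e_n=t^{n+\mu}(dt)^{-\lambda}$, $n\in\mathbb{Z}_{\ge 0}$. (1) If $\mu\neq(m+k+1)\lambda$ for every positive integer $k$, then the normal forms in a general position in $F_{\lambda\mu}$ are $c_0e_0+c_1e_1+\dots+c_me_m$ with any $c_0\in f^\ast$, $c_1,\dots,c_m\in f$. (2) If $\lambda\neq 0$ and $\mu=(m+k+1)\lambda$ for a positive integer $k$, then the normal forms in a general position in $F_{\lambda\mu}$ are $c_0e_0+c_1e_1+\dots+c_me_m+c_{m+k}e_{m+k}$ with any $c_0\in f^\ast$, $c_1,\dots,c_m,c_{m+k}\in f$. (3) Each normal form in a general position in $F_{\lambda\mu}$ is a normal form in $F_{\lambda,\mu-n}$ for every nonnegative integer $n$. (4) Each normal form in $F_{\lambda\mu}$ is a normal form in a general position in $F_{\lambda,\mu+n}$ for some nonnegative integer $n$, except for the case when $\lambda=0$ and $\mu$ is a non-positive integer, in which case there are additional normal forms $c+C$, for any constant $c\in f^\ast$ and any $C$ that is a normal form in a general position in $F_{0n}$ with a positive integer $n$.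
   Context: $L_n$ ($n>0$) is the Lie algebra generated by $(l_i)_{i\ge n}$ with $[l_i,l_j]=(j-i)l_{i+j}$, realized by $l_i=t^{i+1}\frac{d}{dt}$. $G_n$ is the group of automorphisms $g$ of the algebra $f[[t]]$ of formal power series such that $g(t)=t+o(t^n)$; $L_n$ is regarded as the Lie algebra of $G_n$. $L_n^\ast$ has basis $(y_i)_{i\ge n}$ dual to $(l_i)_{i\ge n}$. $G_{m+1}$ acts on $F_{\lambda\mu}$ by substitution: $\varphi(t)\,t^\mu(dt)^{-\lambda}\mapsto\varphi(g(t))\,(g(t)/t)^\mu\,g'(t)^{-\lambda}\,t^\mu(dt)^{-\lambda}$, with powers of series with constant term $1$ given by the binomial series; $L_{m+1}$ acts correspondingly by $l_i e_n=(n+\mu-(i+1)\lambda)e_{n+i}$. For a nonnegative integer $n$, $F_{\lambda,\mu+n}$ is regarded as a subspace of $F_{\lambda\mu}$ via $t^{\mu+n}f[[t]]\subseteq t^\mu f[[t]]$. Write $x=\sum_{n\ge 0}x_ne_n$. Put $x\preceq y$ iff for every $j$ with $x_j\ne 0$, $y_j=0$ there is $i\le j$ with $x_i=0$, $y_i\ne 0$; and $x\prec y$ iff $x\preceq y$ and $y\not\preceq x$. A normal form in $F_{\lambda\mu}$ is the lowest point of a $G_{m+1}$-orbit, i.e. a point $x$ with $x\prec y$ for every $y\ne x$ in its orbit. For $j<k$ let $w(j,k)=(j+\mu-(k-j+1)\lambda)\,y_{k-j}\in L_{m+1}^\ast$ if $k-j>m$ and $w(j,k)=0$ otherwise, so that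 $\sum_{j<k}x_jw(j,k)$ is the linear form $l\mapsto (l\,x)_k$. For a given $x$, define the memorized forms recursively in $k=0,1,2,\dots$: the form $\sum_{j<k}x_jw(j,k)$ is memorized at index $k$ iff it does not lie in the span of the forms memorized at smaller indices. The basic normal forms in a general position are the $x$ constructed recursively by: $x_0$ is an arbitrary element of $f^\ast$; for $k\geq 1$, $x_k=0$ if a form is memorized at index $k$, and $x_k$ is an arbitrary element of $f^\ast$ otherwise. By convention, normal forms having forms memorized at exactly the same indices as the basic normal forms in a general position are also called normal forms in a general position.
   Formalization: In (2) with k=1 the description is asserted only for points with x_0≠0 (some general-position normal forms have x_0=0); in (4) the normal form 0 is excluded, and for λ=0, μ a non-positive integer, the bare constants c (C=0) are listed as a further case. *)

(* Defs.v *)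
(* MathComp, with boolp for classical logic. *)
From HB Require Import structures.
From mathcomp Require Import all_boot all_algebra.
From mathcomp Require Import boolp.

Set Implicit Arguments.
Unset Strict Implicit.
Unset Printing Implicit Defensive.

Import GRing.Theory.
Local Open Scope ring_scope.

(* The algebra f[[t]], a series being its sequence of coefficients. *)
Definition fps (f : fieldType) : Type := nat -> f.

Section PowerSeriesAlgebra.
Variable f : fieldType.
Implicit Types a b c : fps f.

HB.instance Definition _ := gen_eqMixin (fps f).
HB.instance Definition _ := gen_choiceMixin (fps f).

Definition fps_zero : fps f := fun=> 0.
Definition fps_opp a : fps f := fun n => - a n.
Definition fps_add a b : fps f := fun n => a n + b n.
Definition fps_scale (k : f) a : fps f := fun n => k * a n.
Definition fps_one : fps f := fun n => (n == 0%N)%:R.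
Definition fps_mul a b : fps f := fun n => \sum_(i < n.+1) a i * b (n - i)%N.

Fact fps_addA : associative fps_add.
Proof. by move=> a b c; apply/funext => n; rewrite /fps_add addrA. Qed.
Fact fps_addC : commutative fps_add.
Proof. by move=> a b; apply/funext => n; rewrite /fps_add addrC. Qed.
Fact fps_add0 : left_id fps_zero fps_add.
Proof. by move=> a; apply/funext => n; rewrite /fps_add add0r. Qed.
Fact fps_addN : left_inverse fps_zero fps_opp fps_add.
Proof. by move=> a; apply/funext => n; rewrite /fps_add addNr. Qed.

HB.instance Definition _ :=
  GRing.isZmodule.Build (fps f) fps_addA fps_addC fps_add0 fps_addN.

Let trunc N a : {poly f} := \poly_(i < N) a i.

Let mul_trunc N a b n : (n < N)%N ->
  fps_mul a b n = (trunc N a * trunc N b)`_n.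
Proof.
move=> ltnN; rewrite coefM; apply: eq_bigr => i _; rewrite !coef_poly.
by rewrite (leq_trans (ltn_ord i) ltnN) (leq_ltn_trans (leq_subr _ _) ltnN).
Qed.

Fact fps_mulA : associative fps_mul.
Proof.
move=> a b c; apply/funext => n; pose t x := trunc n.+1 x.
transitivity ((t a * (t b * t c))`_n).
  rewrite coefM; apply: eq_bigr => i _.
  by rewrite coef_poly ltn_ord (@mul_trunc n.+1) // ltnS leq_subr.
rewrite mulrA coefM; apply: eq_bigr => i _.
by rewrite coef_poly ltnS leq_subr (@mul_trunc n.+1).
Qed.
Fact fps_mulC : commutative fps_mul.
Proof. by move=> a b; apply/funext => n; rewrite !(@mul_trunc n.+1) // mulrC. Qed.
Fact fps_mul1 : left_id fps_one fps_mul.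
Proof.
move=> a; apply/funext => n; rewrite /fps_mul big_ord_recl subn0 mul1r.
by rewrite big1 ?addr0 // => i _; rewrite mul0r.
Qed.
Fact fps_mulDl : left_distributive fps_mul fps_add.
Proof.
move=> a b c; apply/funext => n; rewrite /fps_mul /fps_add -big_split.
by apply: eq_bigr => i _; rewrite mulrDl.
Qed.
Fact fps_one_neq0 : fps_one != fps_zero.
Proof. by apply/eqP => /(congr1 (@^~ 0%N))/eqP; rewrite (negPf (oner_neq0 f)). Qed.

HB.instance Definition _ := GRing.Zmodule_isComNzRing.Build (fps f)
  fps_mulA fps_mulC fps_mul1 fps_mulDl fps_one_neq0.

Fact fps_scaleA k l a : fps_scale k (fps_scale l a) = fps_scale (k * l) a.
Proof. by apply/funext => n; rewrite /fps_scale mulrA. Qed.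
Fact fps_scale1 : left_id 1 fps_scale.
Proof. by move=> a; apply/funext => n; rewrite /fps_scale mul1r. Qed.
Fact fps_scaleDr : right_distributive fps_scale +%R.
Proof. by move=> k a b; apply/funext => n; apply: mulrDr. Qed.
Fact fps_scaleDl a : {morph fps_scale^~ a : k l / k + l}.
Proof. by move=> k l; apply/funext => n; apply: mulrDl. Qed.

HB.instance Definition _ := GRing.Zmodule_isLmodule.Build f (fps f)
  fps_scaleA fps_scale1 fps_scaleDr fps_scaleDl.

Fact fps_scaleAl (k : f) a b : k *: (a * b) = (k *: a) * b.
Proof.
apply/funext => n; rewrite [LHS]mulr_sumr.
by apply: eq_bigr => i _; rewrite mulrA.
Qed.

HB.instance Definition _ := GRing.Lmodule_isLalgebra.Build f (fps f) fps_scaleAl.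
HB.instance Definition _ := GRing.Lalgebra_isComAlgebra.Build f (fps f).

Definition fpsX : fps f := fun n => (n == 1%N)%:R.

Definition fps_deriv a : fps f := fun n => n.+1%:R * a n.+1.

(* a / t, for a without constant term *)
Definition fps_divX a : fps f := fun n => a n.+1.

(* a(g(t)), for g without constant term: g ^+ k contributes to the coefficients
   of index at least k only. *)
Definition fps_comp a (g : fps f) : fps f :=
  fun n => \sum_(k < n.+1) a k * (g ^+ k) n.

(* the binomial coefficient "alpha choose k" *)
Definition gbinom (alpha : f) (k : nat) : f :=
  (\prod_(i < k) (alpha - i%:R)) / k`!%:R.

(* u ^ alpha = sum_k (alpha choose k) (u - 1)^k, for u with constant term 1 *)
Definition fps_powr (u : fps f) (alpha : f) : fps f :=
  fun n => \sum_(k < n.+1) gbinom alpha k * ((u - 1) ^+ k) n.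

(* g belongs to G_n, i.e., g is an automorphism and g(t) = t + o(t^n) *)
Definition in_G (n : nat) (g : {lrmorphism fps f -> fps f}) : Prop :=
  bijective g /\ forall i, (i <= n)%N -> g fpsX i = fpsX i.

End PowerSeriesAlgebra.

Arguments fpsX {f}.

(* The elements phi(t) t^mu (dt)^(-lambda) of F_{lambda,mu} are represented by
   phi : fps f.  Hence x n is the coordinate of x on e_n, e_n is 'X^n, and the
   inclusion of F_{lambda,mu+n} in F_{lambda,mu} is multiplication by t^n. *)
Section NormalForms.
Variables (f : fieldType) (m : nat).
Implicit Types (lambda mu : f) (x y : fps f).

Definition basis_e (n : nat) : fps f := fpsX ^+ n.

Definition incl (n : nat) x : fps f := fpsX ^+ n * x.

Definition act lambda mu (g : {lrmorphism fps f -> fps f}) x : fps f :=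
  let gt := g fpsX in
  fps_comp x gt * fps_powr (fps_divX gt) mu * fps_powr (fps_deriv gt) (- lambda).

Definition in_orbit lambda mu x y : Prop :=
  exists2 g, in_G m.+1 g & y = act lambda mu g x.

Definition preceq x y : Prop :=
  forall j, x j != 0 -> y j = 0 -> exists i, [/\ (i <= j)%N, x i = 0 & y i != 0].

Definition prec x y : Prop := preceq x y /\ ~ preceq y x.

Definition normal_form lambda mu x : Prop :=
  forall y, in_orbit lambda mu x y -> y <> x -> prec x y.

(* L_{m+1}^* has basis (y_i)_{i > m}: its elements are represented by
   polynomials, y_i being 'X^i. *)
Definition wform lambda mu (j k : nat) : {poly f} :=
  if (m < k - j)%N then (j%:R + mu - (k - j + 1)%:R * lambda) *: 'X^(k - j)
  else 0.

(* the linear form l |-> (l x)_k *)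
Definition lform lambda mu x (k : nat) : {poly f} :=
  \sum_(j < k) x j *: wform lambda mu j k.

Definition in_span (s : seq {poly f}) (p : {poly f}) : Prop :=
  exists c : nat -> f, p = \sum_(i < size s) c i *: s`_i.

(* the indices smaller than k at which a form is memorized *)
Fixpoint memorized_before lambda mu x (k : nat) : seq nat :=
  if k is k'.+1 then
    let s := memorized_before lambda mu x k' in
    if `[< in_span (map (lform lambda mu x) s) (lform lambda mu x k') >]
    then s else rcons s k'
  else [::].

Definition memorized lambda mu x (k : nat) : Prop :=
  ~ in_span (map (lform lambda mu x) (memorized_before lambda mu x k))
            (lform lambda mu x k).

Definition basic_normal_form lambda mu x : Prop :=
  x 0%N != 0 /\
  forall k, (0 < k)%N -> (memorized lambda mu x k -> x k = 0) /\
                         (~ memorized lambda mu x k -> x k != 0).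

(* "normal forms in a general position" *)
Definition general_normal_form lambda mu x : Prop :=
  normal_form lambda mu x /\
  exists2 b, basic_normal_form lambda mu b
           & forall k, memorized lambda mu x k <-> memorized lambda mu b k.

End NormalForms.

Arguments basis_e {f}.

(* Main.v *)
(* If g(t) = t + a t^(k+1) modulo t^(k+2), then g fixes the coordinates of index
   less than k and adds a (mu - (k+1) lambda) x_0 to the k-th one.  Hence, when
   x_0 <> 0, a coordinate x_k with k > m and mu <> (k+1) lambda can be killed
   without changing the previous ones, so it is 0 in a normal form.  Conversely,
   if all these coordinates are 0, let k be the first index where x and a point
   g x of its orbit differ.  Either x_k = 0, or mu = (k+1) lambda; in the latter
   case k is the only exceptional index (lambda = mu = 0 being excluded), so g is
   t modulo t^(k+1) and cannot change x_k after all.  The same indices are the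
   memorized ones, because the form at k has y_k-coefficient
   x_0 (mu - (k+1) lambda).  So normal forms with x_0 <> 0 are exactly those in a
   general position, and multiplication by t^n intertwines the actions on
   F_{lambda,mu+n} and F_{lambda,mu}, which reduces the rest to x_0 <> 0.  For
   lambda = mu = 0 constants are fixed and can be split off. *)

From HB Require Import structures.
Require Import Defs.
From mathcomp Require Import all_boot all_algebra.
From mathcomp Require Import boolp.

Set Implicit Arguments.
Unset Strict Implicit.
Unset Printing Implicit Defensive.

Import GRing.Theory.
Local Open Scope ring_scope.

(** * Coefficients of power series and congruences *)

Section Coefficients.
Context {f : fieldType}.
Implicit Types (a b u v w x y : fps f) (p : {poly f}).

Lemma fps_coefD a b n : (a + b) n = a n + b n. Proof. by []. Qed.
Lemma fps_coefN a n : (- a) n = - a n. Proof. by []. Qed.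
Lemma fps_coefZ c a n : (c *: a) n = c * a n. Proof. by []. Qed.
Lemma fps_coef1 n : (1 : fps f) n = (n == 0%N)%:R. Proof. by []. Qed.
Lemma fps_coefM a b n : (a * b) n = \sum_(i < n.+1) a i * b (n - i)%N.
Proof. by []. Qed.

Lemma fps_coef_sum (I : Type) (r : seq I) (P : pred I) (F : I -> fps f) n :
  (\sum_(i <- r | P i) F i) n = \sum_(i <- r | P i) F i n.
Proof. by apply: (big_morph (fun a => a n)) => // a b; rewrite fps_coefD. Qed.

Lemma fps_coefM0 a b : (a * b) 0%N = a 0%N * b 0%N.
Proof. by rewrite fps_coefM big_ord1. Qed.

Lemma fps_coefXM a n : (fpsX * a) n = if n is n'.+1 then a n' else 0.
Proof.
rewrite fps_coefM big_ord_recl mul0r add0r.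
case: n => [|n]; first by rewrite big_ord0.
rewrite big_ord_recl /= mul1r subSS subn0 big1 ?addr0 // => i _.
by rewrite mul0r.
Qed.

Lemma fps_coefXnM k a n :
  (fpsX ^+ k * a) n = if (n < k)%N then 0 else a (n - k)%N.
Proof.
elim: k n => [|k IHk] n; first by rewrite expr0 mul1r subn0.
by rewrite exprS -mulrA fps_coefXM; case: n => // n; rewrite IHk subSS.
Qed.

Lemma fps_coefXn k n : (fpsX ^+ k : fps f) n = (n == k)%:R.
Proof.
rewrite -[_ ^+ k]mulr1 fps_coefXnM fps_coef1 subn_eq0.
by case: ltngtP.
Qed.

Lemma fps_XnE k a : (forall i, (i < k)%N -> a i = 0) ->
  a = fpsX ^+ k * (fun n => a (k + n)%N : f).
Proof.
move=> ak; apply/funext => n; rewrite fps_coefXnM.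
by case: ltnP => [/ak|/subnKC ->].
Qed.

(** Congruence modulo [t^N]. *)
Definition eqfps N a b := forall n, (n < N)%N -> a n = b n.

Lemma eqfpsM N a a' b b' : eqfps N a a' -> eqfps N b b' ->
  eqfps N (a * b) (a' * b').
Proof.
move=> aa bb n ltnN; apply: eq_bigr => i _; rewrite aa ?bb //.
  exact: leq_ltn_trans (leq_subr _ _) ltnN.
by rewrite (leq_trans (ltn_ord i)).
Qed.

Lemma eqfpsX N a a' k : eqfps N a a' -> eqfps N (a ^+ k) (a' ^+ k).
Proof. by move=> aa; elim: k => // k IH; rewrite !exprS; apply: eqfpsM. Qed.

Lemma fps_coef_expr_small u k n : u 0%N = 0 -> (n < k)%N -> (u ^+ k) n = 0.
Proof.
move=> u0 ltnk; rewrite (@fps_XnE 1 u) => [|[]//].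
by rewrite expr1 exprMn fps_coefXnM ltnk.
Qed.

(** * Substitution as an automorphism of the algebra of series *)

Lemma coef_horner_alg u p N n : (size p <= N)%N ->
  horner_alg u p n = \sum_(k < N) p`_k * (u ^+ k) n.
Proof.
move=> lepN; rewrite /horner_alg /horner_morph.
rewrite (@horner_coef_wide _ N) ?size_map_poly // fps_coef_sum.
by apply: eq_bigr => i _; rewrite coef_map /= mulr_algl.
Qed.

(** Links composition to polynomial evaluation in the algebra of series, whose morphism laws are
    known: terms of degree above n do not reach the n-th coefficient, since [u ^+ k] has order at
    least k. *)
Lemma fps_comp_horner x u p n : u 0%N = 0 ->
  (forall i, (i <= n)%N -> p`_i = x i) -> fps_comp x u n = horner_alg u p n.
Proof.
move=> u0 px; rewrite (@coef_horner_alg u p (maxn n.+1 (size p))) ?leq_maxr //.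
rewrite -(big_mkord xpredT (fun k => p`_k * (u ^+ k) n)).
rewrite (big_cat_nat (leq0n _) (leq_maxl n.+1 _)) /= [X in _ + X]big_nat.
rewrite [X in _ + X]big1 => [|i /andP[ltni _]].
  rewrite addr0 big_mkord.
  by apply: eq_bigr => i _; rewrite px -1?ltnS.
by rewrite fps_coef_expr_small // mulr0.
Qed.

Lemma fps_compD u x y : fps_comp (x + y) u = fps_comp x u + fps_comp y u.
Proof.
apply/funext => n; rewrite fps_coefD -big_split.
by apply: eq_bigr => i _; rewrite fps_coefD mulrDl.
Qed.

Lemma fps_compZ u c x : fps_comp (c *: x) u = c *: fps_comp x u.
Proof.
apply/funext => n; rewrite fps_coefZ mulr_sumr.
by apply: eq_bigr => i _; rewrite fps_coefZ mulrA.
Qed.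

Lemma fps_comp1 u : fps_comp 1 u = 1.
Proof.
apply/funext => n; rewrite /fps_comp big_ord_recl expr0 mul1r big1 ?addr0 //.
by move=> i _; rewrite fps_coef1 mul0r.
Qed.

Lemma fps_compX u : u 0%N = 0 -> fps_comp fpsX u = u.
Proof.
move=> u0; apply/funext => n; rewrite (@fps_comp_horner _ _ 'X) //.
  by rewrite horner_algX.
by move=> i _; rewrite coefX.
Qed.

(** For the n-th coefficient, both series may be truncated to polynomials, on which evaluation at u
    is multiplicative. *)
Lemma fps_compM u x y : u 0%N = 0 ->
  fps_comp (x * y) u = fps_comp x u * fps_comp y u.
Proof.
move=> u0; apply/funext => n; pose t (z : fps f) := \poly_(i < n.+1) z i.
have tE z i : (i <= n)%N -> (t z)`_i = z i by rewrite coef_poly ltnS => ->.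
rewrite (@fps_comp_horner _ _ (t x * t y)) // => [|i lein].
  rewrite rmorphM; apply: eq_bigr => i _; congr (_ * _).
    rewrite (@fps_comp_horner _ _ (t x)) // => j leji.
    by rewrite tE // (leq_trans leji) -1?ltnS.
  rewrite (@fps_comp_horner _ _ (t y)) // => j leji.
  by rewrite tE // (leq_trans leji) ?leq_subr.
rewrite coefM; apply: eq_bigr => j _; rewrite !tE //.
  by rewrite (leq_trans (leq_subr _ _)).
by rewrite (leq_trans _ lein) -1?ltnS.
Qed.

Lemma fps_compXn u x k : u 0%N = 0 -> fps_comp (x ^+ k) u = fps_comp x u ^+ k.
Proof.
move=> u0; elim: k => [|k IHk]; first exact: fps_comp1.
by rewrite !exprS fps_compM ?IHk.
Qed.

(** Carries the proof [u0] as an argument so that the linear and multiplicative structures can be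
    attached to it. *)
Definition comp_at u (u0 : u 0%N = 0) : fps f -> fps f := fun x => fps_comp x u.

Fact comp_at_linear u (u0 : u 0%N = 0) : linear (@comp_at u u0).
Proof. by move=> c x y; rewrite /comp_at fps_compD fps_compZ. Qed.

Fact comp_at_monoid u (u0 : u 0%N = 0) : monoid_morphism (@comp_at u u0).
Proof. by split=> [|x y]; [apply: fps_comp1 | apply: fps_compM]. Qed.

HB.instance Definition _ u (u0 : u 0%N = 0) :=
  GRing.isLinear.Build f (fps f) (fps f) *:%R (@comp_at u u0)
    (@comp_at_linear u u0).
HB.instance Definition _ u (u0 : u 0%N = 0) :=
  GRing.isMonoidMorphism.Build (fps f) (fps f) (@comp_at u u0)
    (@comp_at_monoid u u0).

(** Substitution of a series t + O(t^2) is triangular with unit diagonal; injectivity and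
    surjectivity both rest on this. *)
Lemma fps_comp_coef u x n : eqfps 2 u fpsX ->
  fps_comp x u n = x n + \sum_(k < n) x k * (u ^+ k) n.
Proof.
move=> uX; rewrite /fps_comp big_ord_recr addrC /=; congr (_ + _).
rewrite (@fps_XnE 1 u) => [|[|//] _]; last exact: uX.
rewrite expr1 exprMn fps_coefXnM ltnn subnn.
suff -> : (((fun k => u (1 + k)%N) : fps f) ^+ n) 0%N = 1 by rewrite mulr1.
elim: n => // n IHn; rewrite exprS fps_coefM0 IHn mulr1 addn0.
by rewrite uX.
Qed.

Lemma fps_comp_inj u : eqfps 2 u fpsX -> injective (fun x => fps_comp x u).
Proof.
move=> uX x y xy; apply/funext => n; elim/ltn_ind: n => n IHn.
have := congr1 (fun z : fps f => z n) xy; rewrite /= !fps_comp_coef //.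
by under eq_bigr => i _ do rewrite IHn //; apply: addIr.
Qed.

Lemma fps_comp_surj u y : eqfps 2 u fpsX -> exists x, fps_comp x u = y.
Proof.
(* Each coefficient of the preimage depends on all the earlier ones: [pre n] lists the first n of
   them and [next] solves the triangular equation for the following one. *)
move=> uX; pose next (s : seq f) : f :=
  y (size s) - \sum_(k < size s) s`_k * (u ^+ k) (size s).
pose pre := fix pre n :=
  if n is n'.+1 then rcons (pre n') (next (pre n')) else [::].
have spre n : size (pre n) = n by elim: n => //= n IHn; rewrite size_rcons IHn.
pose x : fps f := fun n => next (pre n).
have xE n k : (k < n)%N -> (pre n)`_k = x k.
  elim: n => // n IHn; rewrite ltnS leq_eqVlt nth_rcons spre.
  by case: ltngtP => // [ltkn _|-> //]; apply: IHn.
exists x; apply/funext => n; rewrite fps_comp_coef // {1}/x /next spre.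
rewrite -addrA [X in _ + X]addrC [X in _ + X](_ : _ = 0) ?addr0 //.
apply/eqP; rewrite subr_eq0; apply/eqP/eq_bigr => i _.
by rewrite xE.
Qed.

(** Lets group elements be prescribed by their series g(t) alone; n > 0 makes the linear coefficient
    1, hence substitution bijective. *)
Lemma in_G_exists n u : (0 < n)%N -> eqfps n.+1 u fpsX ->
  exists2 g : {lrmorphism fps f -> fps f}, in_G n g & g fpsX = u.
Proof.
move=> n0 uX; have uX2 : eqfps 2 u fpsX.
  by move=> i /leq_trans lti; apply/uX/lti.
have u0 : u 0%N = 0 by rewrite uX.
exists (comp_at u0); last exact: fps_compX.
split=> [|i lein]; last by rewrite /= /comp_at fps_compX ?uX.
have [h hK] := choice (fun y => fps_comp_surj y uX2).
by exists h => // x; apply: (fps_comp_inj uX2); apply: hK.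
Qed.

(** * Binomial coefficients and binomial powers *)

Lemma gbinom0 (alpha : f) : gbinom alpha 0 = 1.
Proof. by rewrite /gbinom big_ord0 divr1. Qed.

Lemma gbinom1 (alpha : f) : gbinom alpha 1 = alpha.
Proof. by rewrite /gbinom big_ord1 subr0 divr1. Qed.

Lemma gbinom0S k : gbinom (0 : f) k.+1 = 0.
Proof. by rewrite /gbinom big_ord_recl subr0 !mul0r. Qed.

Lemma gbinomS (alpha : f) k : [pchar f] =i pred0 ->
  gbinom (alpha + 1) k.+1 = gbinom alpha k.+1 + gbinom alpha k.
Proof.
move=> /pcharf0P ch0; rewrite /gbinom big_ord_recl big_ord_recr /= subr0.
under eq_bigr => i _ do rewrite /bump /= add1n -natr1 opprD addrACA subrr addr0.
(* The three numerators are [(alpha + 1) * P], [P * (alpha - k)] and [P]; characteristic 0 allows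
   clearing the factorials. *)
set P := \prod_(i < k) _.
have k0 : k`!%:R != 0 :> f by rewrite ch0 -lt0n fact_gt0.
have k1 : k.+1%:R != 0 :> f by rewrite ch0.
rewrite factS natrM.
apply: (mulIf (mulf_neq0 k1 k0)).
have kk0 : k.+1%:R * k`!%:R != 0 :> f by rewrite mulf_neq0.
rewrite mulfVK // [RHS]mulrDl mulfVK // [X in _ = _ + _ * X]mulrC [_ / _ * _]mulrA.
by rewrite mulfVK // -mulrDr -natr1 addrA subrK mulrC.
Qed.

Lemma fps_powr0 u : fps_powr u 0 = 1.
Proof.
apply/funext => n; rewrite /fps_powr big_ord_recl gbinom0 mul1r big1 ?addr0 //.
by move=> i _; rewrite gbinom0S mul0r.
Qed.

(** A binomial power is the binomial series composed with v = u - 1. Writing u as v + 1, the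
    identity becomes Pascal's rule, coefficient by coefficient. *)
Lemma fps_powrS u alpha : [pchar f] =i pred0 -> u 0%N = 1 ->
  fps_powr u (alpha + 1) = u * fps_powr u alpha.
Proof.
move=> ch0 u0; set v := u - 1.
have v0 : v 0%N = 0 by rewrite /v fps_coefD fps_coefN u0 subrr.
have powE (b : f) : fps_powr u b = fps_comp (gbinom b) v by [].
rewrite !powE -{1}[u](subrK 1) -/v -{2}[v]fps_compX // mulrDl mul1r -fps_compM //.
rewrite -fps_compD; congr fps_comp; apply/funext => -[|k].
  by rewrite fps_coefD fps_coefXM add0r !gbinom0.
by rewrite fps_coefD fps_coefXM gbinomS // addrC.
Qed.

Lemma fps_powrDn u alpha n : [pchar f] =i pred0 -> u 0%N = 1 ->
  fps_powr u (alpha + n%:R) = u ^+ n * fps_powr u alpha.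
Proof.
move=> ch0 u0; elim: n => [|n IHn]; first by rewrite addr0 mul1r.
by rewrite -natr1 addrA fps_powrS // IHn exprS mulrA.
Qed.

End Coefficients.

(** * The action to first order *)

Section FirstOrder.
Context {f : fieldType}.
Implicit Types (u x y : fps f) (a lambda mu alpha : f).

Lemma fps_coef_perturb k a n :
  (1 + a *: fpsX ^+ k : fps f) n = (n == 0%N)%:R + a * (n == k)%:R.
Proof. by rewrite fps_coefD fps_coefZ fps_coefXn. Qed.

(** The i-th power of u - 1 has order at least k i, so only the first two terms of the binomial
    series survive modulo [t^(k+1)]. *)
Lemma fps_powr_perturb k u a alpha : (0 < k)%N ->
  eqfps k.+1 u (1 + a *: fpsX ^+ k) ->
  eqfps k.+1 (fps_powr u alpha) (1 + (alpha * a) *: fpsX ^+ k).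
Proof.
move=> k0 uE n ltnk; rewrite fps_coef_perturb.
have vE : eqfps k.+1 (u - 1) (a *: fpsX ^+ k).
  by move=> i lti; rewrite fps_coefD uE // fps_coefD fps_coefN addrAC subrr add0r.
have powE i : ((u - 1) ^+ i) n = a ^+ i * (n == k * i)%N%:R.
  rewrite (eqfpsX i vE) // exprZn fps_coefZ -exprM fps_coefXn.
  by [].
rewrite /fps_powr big_ord_recl powE gbinom0 muln0 mul1r expr0 mul1r; congr (_ + _).
case: n ltnk powE => [|n] ltnk powE.
  by rewrite big_ord0 eq_sym (gtn_eqF k0) mulr0.
rewrite big_ord_recl powE gbinom1 muln1 expr1 mulrA big1 ?addr0 // => i _.
rewrite powE (_ : n.+1 == _ = false) ?mulr0 //.
apply: ltn_eqF; apply: leq_trans ltnk _; rewrite !lift0 mulnS.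
by rewrite -[X in (X < _)%N]addn0 ltn_add2l muln_gt0 k0.
Qed.

Lemma fps_comp_perturb N u x : eqfps N u fpsX -> eqfps N (fps_comp x u) x.
Proof.
move=> uX n ltnN; rewrite /fps_comp big_ord_recr /= (eqfpsX n uX) //.
rewrite fps_coefXn eqxx mulr1 big1 ?add0r // => i _.
by rewrite (eqfpsX i uX) // fps_coefXn (gtn_eqF (ltn_ord i)) mulr0.
Qed.

Lemma fps_coefM_perturb k x a n : (0 < k)%N -> (n <= k)%N ->
  (x * (1 + a *: fpsX ^+ k)) n = x n + (n == k)%:R * (a * x 0%N).
Proof.
move=> k0 lenk; rewrite mulrDr mulr1 -scalerAr mulrC fps_coefD fps_coefZ.
rewrite fps_coefXnM; case: ltngtP lenk => //= [ltnk|->] _.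
  by rewrite mulr0 mul0r.
by rewrite subnn mul1r.
Qed.

(* To first order, t + a t^(k+1) acts as 1 + a l_k. *)
Lemma act_coef lambda mu (g : {lrmorphism fps f -> fps f}) x k n : (0 < k)%N ->
  eqfps k.+1 (g fpsX) fpsX -> (n <= k)%N ->
  act lambda mu g x n =
    x n + (n == k)%:R * ((mu - k.+1%:R * lambda) * g fpsX k.+1 * x 0%N).
Proof.
move=> k0; rewrite /act; move: (g fpsX) => u uX lenk; set a := u k.+1.
have divE : eqfps k.+1 (fps_divX u) (1 + a *: fpsX ^+ k).
  move=> i; rewrite ltnS leq_eqVlt fps_coef_perturb /fps_divX.
  case: ltngtP => // [ltik|->] _; last by rewrite gtn_eqF // add0r mulr1.
  by rewrite uX // mulr0 addr0.
have derE : eqfps k.+1 (fps_deriv u) (1 + (k.+1%:R * a) *: fpsX ^+ k).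
  move=> i; rewrite ltnS leq_eqVlt fps_coef_perturb /fps_deriv.
  case: ltngtP => // [ltik|->] _; last by rewrite gtn_eqF // add0r mulr1.
  rewrite uX // mulr0 addr0 /fpsX eqSS.
  by case: i {ltik} => [|i]; rewrite ?mulr1 ?mulr0.
(* At index k, the three factors contribute x_k, [mu * a * x_0] and [- lambda * (k+1) * a * x_0]. *)
rewrite (eqfpsM (eqfpsM (fps_comp_perturb x uX)
  (fps_powr_perturb mu k0 divE)) (fps_powr_perturb (- lambda) k0 derE)) //.
rewrite !fps_coefM_perturb // (ltn_eqF k0) mul0r addr0 -addrA -mulrDr.
by rewrite !mulrBl !mulNr mulrA [lambda * _]mulrC.
Qed.

End FirstOrder.

(** * The order, and normal forms with nonzero constant term *)

Section NormalForms.
Context {f : fieldType} (m : nat).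
Implicit Types (lambda mu c : f) (x y z : fps f).

(** The first differing index decides the order when x vanishes there: k itself is the required
    smaller witness for every later index. *)
Lemma prec_first x y k : eqfps k x y -> x k = 0 -> y k != 0 -> prec x y.
Proof.
move=> xy xk yk; split=> [j xj yj|yx].
  case: (leqP k j) => [lekj|/xy]; first by exists k.
  by rewrite yj => xj0; rewrite xj0 eqxx in xj.
have [i []] := yx k yk xk.
rewrite leq_eqVlt => /orP[/eqP->|/xy -> ->]; last by rewrite eqxx.
by move=> yk0; rewrite yk0 eqxx in yk.
Qed.

(** At most one index is exceptional: lambda = 0 would force mu = 0, and otherwise lambda
    cancels. *)
Lemma natr_exceptional lambda mu k l : [pchar f] =i pred0 ->
  (lambda != 0) || (mu != 0) -> mu = k%:R * lambda -> mu = l%:R * lambda -> k = l.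
Proof.
move=> /pcharf0P ch0; case: (eqVneq lambda 0) => [->|l0] /= nz muk.
  by rewrite muk mulr0 eqxx in nz.
rewrite {}muk {nz mu} => /(mulIf l0); wlog lekl : k l / (k <= l)%N => [H|].
  by case: (leqP k l) => [/H//|/ltnW/H {}H /esym/H].
move/esym/eqP; rewrite -subr_eq0 -natrB // ch0 subn_eq0 => lelk.
by apply/eqP; rewrite eqn_leq lekl.
Qed.

Lemma normal_formP lambda mu x : [pchar f] =i pred0 ->
  (lambda != 0) || (mu != 0) -> x 0%N != 0 ->
  normal_form m lambda mu x <->
  forall k, (m < k)%N -> mu <> k.+1%:R * lambda -> x k = 0.
Proof.
move=> ch0 nz x0; split=> [xN k ltmk muk|x_eq0 y [g [_ gX] yE] /eqP yx].
  apply: contra_notP (muk) => /eqP xk; apply/eqP; apply: contraT => muk'.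
  have k0 : (0 < k)%N by apply: leq_trans ltmk.
  have d0 : mu - k.+1%:R * lambda != 0 by rewrite subr_eq0.
  (* Solves [(mu - (k+1) lambda) * a * x_0 = - x_k], so that the k-th coordinate is killed. *)
  pose a := - x k / ((mu - k.+1%:R * lambda) * x 0%N).
  pose u : fps f := fpsX + a *: fpsX ^+ k.+1.
  have uE i : u i = fpsX i + a * (i == k.+1)%:R.
    by rewrite /u fps_coefD fps_coefZ fps_coefXn.
  have uX : eqfps k.+1 u fpsX by move=> i lti; rewrite uE ltn_eqF // mulr0 addr0.
  have [||g gG gu] := @in_G_exists f m.+1 u => //.
    by move=> i lti; apply: uX; apply: leq_trans lti _.
  have yE n : (n <= k)%N -> act lambda mu g x n = x n - (n == k)%:R * x k.
    move=> lenk; rewrite (act_coef _ _ _ k0) ?gu // -[in RHS]mulrN.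
    congr (_ + _ * _).
    rewrite uE eqxx {1}/fpsX eqSS gtn_eqF // add0r mulr1 /a mulrAC [LHS]mulrC.
    by rewrite mulfVK // mulf_neq0.
  have yk : act lambda mu g x k = 0 by rewrite yE // eqxx mul1r subrr.
  have yx : act lambda mu g x <> x.
    by move=> /(congr1 (fun z : fps f => z k)) /esym/eqP; rewrite yk (negPf xk).
  (* Minimality demands an index i at most k with x_i = 0 and y_i nonzero, but y agrees with x below
     k and vanishes at k. *)
  have [le _] := xN _ (ex_intro2 _ _ g gG erefl) yx.
  have [i [leik xi]] := le k xk yk.
  rewrite yE // xi sub0r; case: (eqVneq i k) => [eik|_].
    by rewrite -eik xi eqxx in xk.
  by rewrite mul0r oppr0 eqxx.
have ex : exists k, y k != x k.
  by apply: contra_notP (elimN eqP yx) => /forallNP H; apply/funext => k;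
     apply/eqP; apply: contra_notT (H k).
have [k ykx mink] := ex_minnP ex.
have yx_lt : eqfps k x y.
  move=> i ltik; apply/eqP; rewrite eq_sym; apply: contraTT ltik => /mink.
  by rewrite -leqNgt.
have gX' : eqfps m.+2 (g fpsX) fpsX by move=> i lti; apply: gX.
(* Coordinates of index at most m are fixed by [G_{m+1}]. *)
have ltmk : (m < k)%N.
  rewrite ltnNge; apply: contraNN ykx => lekm.
  by rewrite yE (act_coef _ _ _ (ltn0Sn m)) ?ltn_eqF ?mul0r ?addr0 // ltnW.
have [muk|/eqP muk] := eqVneq mu (k.+1%:R * lambda); last first.
  have xk := x_eq0 k ltmk muk.
  by apply: (prec_first yx_lt xk); rewrite -xk.
(* For m < n < k, equality of the n-th coordinates forces [(mu - (n+1) lambda) * g_(n+1) * x_0 = 0];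
   as k is the exceptional index, n is not, so g_(n+1) = 0 and the congruence of g to t gains one
   degree. *)
have gk n : (m < n)%N -> (n <= k)%N -> eqfps n.+1 (g fpsX) fpsX.
  elim: n => // n IHn; rewrite ltnS leq_eqVlt => /orP[/eqP<- _|ltmn ltnk] //.
  move=> i; rewrite ltnS leq_eqVlt => /orP[/eqP->|]; last exact/IHn/ltnW.
  have := yx_lt n ltnk; rewrite yE (act_coef _ _ _ _ (IHn ltmn (ltnW ltnk))) //.
    rewrite eqxx mul1r -[LHS]addr0 => /addrI/esym/eqP; rewrite !mulf_eq0 subr_eq0.
    rewrite (negPf x0) orbF => /orP[/eqP mun|/eqP ->].
      have [ekn] := natr_exceptional ch0 nz muk mun.
      by rewrite ekn ltnn in ltnk.
    by rewrite /fpsX eqSS gtn_eqF // (leq_trans _ ltmn).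
  exact: leq_trans ltmn.
case/negP: ykx; rewrite yE (act_coef _ _ _ _ (gk k ltmk (leqnn k))) //.
  by rewrite muk subrr !mul0r mulr0 addr0.
exact: leq_trans ltmk.
Qed.

(** * Shifting mu, and splitting off constants *)

(** Substitution sends [t^n] to [g(t)^n = t^n (g(t)/t)^n], and the last factor raises the exponent
    mu to mu + n. *)
Lemma act_incl lambda mu g n x : [pchar f] =i pred0 -> in_G m.+1 g ->
  act lambda mu g (incl n x) = incl n (act lambda (mu + n%:R) g x).
Proof.
move=> ch0 [_ gX]; rewrite /act /incl; move: (g fpsX) gX => u uX.
have uE : u = fpsX * fps_divX u.
  by apply/funext => -[|i]; rewrite fps_coefXM //; apply: uX.
have u0 : u 0%N = 0 by rewrite uX.
rewrite fps_compM // fps_compXn // fps_compX // {1}uE exprMn fps_powrDn //.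
  by rewrite -!mulrA; congr (_ * _); rewrite mulrCA.
by rewrite /fps_divX uX.
Qed.

Lemma incl_coef n x k : incl n x (n + k)%N = x k.
Proof. by rewrite /incl fps_coefXnM ltnNge leq_addr addKn. Qed.

Lemma incl_coef_lt n x k : (k < n)%N -> incl n x k = 0.
Proof. by rewrite /incl fps_coefXnM => ->. Qed.

Lemma incl_inj n : injective (@incl f n).
Proof.
by move=> x y xy; apply/funext => k; rewrite -(incl_coef n x) xy incl_coef.
Qed.

Lemma preceq_incl n x y : preceq (incl n x) (incl n y) <-> preceq x y.
Proof.
split=> le j; last first.
  case: (ltnP j n) => [ltjn|/subnKC <-].
    by rewrite incl_coef_lt // eqxx.
  rewrite !incl_coef => xj yj; have [i [leij xi yi]] := le _ xj yj.
  by exists (n + i)%N; rewrite !incl_coef leq_add2l.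
rewrite -(incl_coef n x) -(incl_coef n y) => xj yj.
have [i [leij xi yi]] := le _ xj yj.
have leni : (n <= i)%N.
  by rewrite leqNgt; apply: contraNN yi => ltin; rewrite incl_coef_lt.
by exists (i - n)%N; rewrite leq_subLR -(incl_coef n x) -(incl_coef n y) subnKC.
Qed.

Lemma prec_incl n x y : prec (incl n x) (incl n y) <-> prec x y.
Proof. by rewrite /prec !preceq_incl. Qed.

Lemma normal_form_incl lambda mu n x : [pchar f] =i pred0 ->
  normal_form m lambda mu (incl n x) <-> normal_form m lambda (mu + n%:R) x.
Proof.
move=> ch0; split=> xN y [g gG ->] yx.
  rewrite -(prec_incl n); apply: xN; last by move/incl_inj.
  by exists g => //; rewrite act_incl.
rewrite act_incl // prec_incl; apply: xN; first by exists g.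
by apply: contra_not yx; rewrite act_incl // => ->.
Qed.

(** Index 0, where both sums equal c, can serve neither as an obstruction nor as its witness. *)
Lemma preceq_addC c x y : c != 0 -> x 0%N = 0 -> y 0%N = 0 ->
  preceq (c *: 1 + x) (c *: 1 + y) <-> preceq x y.
Proof.
move=> c0 x0 y0.
have E0 z : z 0%N = 0 -> (c *: 1 + z) 0%N = c.
  by move=> z0; rewrite fps_coefD fps_coefZ z0 addr0 mulr1.
have ES z i : (c *: 1 + z) i.+1 = z i.+1.
  by rewrite fps_coefD fps_coefZ mulr0 add0r.
split=> le [|j].
- by rewrite x0 eqxx.
- rewrite -(ES x) -(ES y) => xj yj; have [[|i] [leij xi yi]] := le _ xj yj.
    by move: c0; rewrite -xi E0 // eqxx.
  by exists i.+1; rewrite -(ES x) -(ES y).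
- by move=> _ cE; move: c0; rewrite -cE E0 // eqxx.
rewrite !ES => xj yj; have [[|i] [leij xi yi]] := le _ xj yj.
  by rewrite y0 eqxx in yi.
by exists i.+1; rewrite !ES.
Qed.

Lemma prec_addC c x y : c != 0 -> x 0%N = 0 -> y 0%N = 0 ->
  prec (c *: 1 + x) (c *: 1 + y) <-> prec x y.
Proof. by move=> c0 x0 y0; rewrite /prec !preceq_addC. Qed.

Lemma act00 g x : act 0 0 g x = fps_comp x (g fpsX).
Proof. by rewrite /act oppr0 !fps_powr0 !mulr1. Qed.

(** For lambda = mu = 0 the action is pure substitution: it fixes constants and preserves the
    vanishing of the constant term. *)
Lemma normal_form_addC c x : c != 0 -> x 0%N = 0 ->
  normal_form m 0 0 (c *: 1 + x) <-> normal_form m 0 0 x.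
Proof.
move=> c0 x0.
have actD g : act 0 0 g (c *: 1 + x) = c *: 1 + act 0 0 g x.
  by rewrite !act00 fps_compD fps_compZ fps_comp1.
have act0 g : act 0 0 g x 0%N = 0.
  by rewrite act00 /fps_comp big_ord1 x0 mul0r.
split=> xN _ [g gG ->] gx.
  rewrite -(@prec_addC c) // -actD; apply: xN; first by exists g.
  by rewrite actD => /addrI.
rewrite actD prec_addC //; apply: xN; first by exists g.
by apply: contra_not gx => gx; rewrite actD gx.
Qed.

End NormalForms.

(** * Spans of linear forms and memorized indices *)

Section Memorized.
Context {f : fieldType}.
Implicit Types (s : seq {poly f}) (p q : {poly f}).

Lemma in_span0 s : in_span s 0.
Proof. by exists (fun=> 0); rewrite big1 // => i _; rewrite scale0r. Qed.

Lemma in_span_linear s p q c : in_span s p -> in_span s q -> in_span s (c *: p + q).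
Proof.
move=> [a ->] [b ->]; exists (fun i => c * a i + b i).
rewrite scaler_sumr -big_split; apply: eq_bigr => i _.
by rewrite scalerDl scalerA.
Qed.

Lemma in_span_mem s p : p \in s -> in_span s p.
Proof.
move=> ps; have lti := ps; rewrite -index_mem in lti.
exists (fun i => (i == index p s)%:R).
rewrite (bigD1 (Ordinal lti)) //= eqxx scale1r nth_index // big1 ?addr0 // => i.
by rewrite -val_eqE /= => /negPf ->; rewrite scale0r.
Qed.

Lemma in_span_coef s p i : in_span s p -> (forall q, q \in s -> q`_i = 0) ->
  p`_i = 0.
Proof.
move=> [c ->] s0; rewrite coef_sum big1 // => j _.
by rewrite coefZ s0 ?mulr0 // mem_nth.
Qed.

Context (m : nat).
Implicit Types (lambda mu : f) (x : fps f).

Lemma mem_memorized_before lambda mu x k j :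
  j \in memorized_before m lambda mu x k <->
  (j < k)%N /\ memorized m lambda mu x j.
Proof.
elim: k => [|k IHk] /=; first by split=> // -[].
case: asboolP => [sp|nsp]; rewrite ?mem_rcons ?in_cons ltnS leq_eqVlt.
  rewrite IHk; split=> [[-> mj]|[/orP[/eqP jk|//] mj]]; first by rewrite orbT.
  by rewrite jk in mj.
split=> [/orP[/eqP ->|/IHk[-> mj]]|[/orP[->//|ltjk] mj]].
- by rewrite eqxx.
- by rewrite orbT.
by apply/orP; right; apply/IHk.
Qed.

Lemma lform_coef0 lambda mu x k i : (i <= m)%N || (k < i)%N ->
  (lform m lambda mu x k)`_i = 0.
Proof.
move=> out; rewrite coef_sum big1 // => j _; rewrite coefZ /wform.
case: ifP => [ltm|_]; last by rewrite coef0 mulr0.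
rewrite coefZ coefXn; case: eqP => [ij|_]; last by rewrite !mulr0.
case/orP: out; rewrite ij; first by rewrite leqNgt ltm.
by rewrite ltnNge leq_subr.
Qed.

Lemma lform_coef lambda mu x k : (m < k)%N ->
  (lform m lambda mu x k)`_k = x 0%N * (mu - k.+1%:R * lambda).
Proof.
case: k => // k ltmk; rewrite coef_sum big_ord_recl big1 ?addr0 => [|j _].
  by rewrite coefZ /wform subn0 ltmk coefZ coefXn eqxx mulr1 add0r addn1.
rewrite coefZ /wform; case: ifP => _; last by rewrite coef0 mulr0.
by rewrite coefZ coefXn lift0 subSS gtn_eqF ?mulr0 // ltnS leq_subr.
Qed.

(** Gaussian elimination from the top: the form at i involves no y_j with j > i and has a nonzero
    y_i-coefficient, so a multiple of the form at n removes y_n from p without leaving the allowed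
    support. *)
Lemma in_span_lforms lambda mu x (s : seq nat) n p :
  (forall i, (m < i < n)%N -> (lform m lambda mu x i)`_i != 0 /\ i \in s) ->
  (forall i, (i <= m)%N || (n <= i)%N -> p`_i = 0) ->
  in_span (map (lform m lambda mu x) s) p.
Proof.
elim: n p => [|n IHn] p hs hp.
  suff -> : p = 0 by apply: in_span0.
  by apply/polyP => i; rewrite coef0 hp // orbT.
have hs' i : (m < i < n)%N -> (lform m lambda mu x i)`_i != 0 /\ i \in s.
  by move=> /andP[ltmi ltin]; apply: hs; rewrite ltmi ltnW.
case: (leqP n m) => [lenm|ltmn].
  apply: IHn => // i out; apply: hp; case/orP: out => [->//|].
  by rewrite leq_eqVlt => /orP[/eqP <-|->]; rewrite ?lenm ?orbT.
have [|ln0 ns] := hs n; first by rewrite ltmn ltnSn.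
set l := lform m lambda mu x n in ln0.
rewrite -[p](subrKC ((p`_n / l`_n) *: l)); apply: in_span_linear.
  by apply/in_span_mem/map_f/ns.
apply: IHn => // i out; rewrite coefB coefZ.
have [->|nin] := eqVneq i n; first by rewrite mulfVK ?subrr ?ln0.
have {}out : (i <= m)%N || (n < i)%N.
  by rewrite ltn_neqAle eq_sym nin.
by rewrite (hp i) // [l`_i]lform_coef0 // mulr0 subrr.
Qed.

Lemma memorizedP lambda mu x k : [pchar f] =i pred0 ->
  (lambda != 0) || (mu != 0) -> x 0%N != 0 ->
  memorized m lambda mu x k <-> (m < k)%N /\ mu <> k.+1%:R * lambda.
Proof.
move=> ch0 nz x0; have lead j : (m < j)%N -> mu <> j.+1%:R * lambda ->
    (lform m lambda mu x j)`_j != 0.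
  by move=> ltmj /eqP muj; rewrite lform_coef // mulf_neq0 // subr_eq0.
(* The forms at earlier indices have no y_j-term, whereas this one does. *)
have mem j : (m < j)%N -> mu <> j.+1%:R * lambda -> memorized m lambda mu x j.
  move=> ltmj muj sp; case/eqP: (lead j ltmj muj); apply: in_span_coef sp _.
  move=> _ /mapP[i /mem_memorized_before[ltij _] ->].
  by rewrite lform_coef0 // ltij orbT.
split=> [mk|[]]; last exact: mem.
suff nspan : ~ ((k <= m)%N \/ mu = k.+1%:R * lambda).
  split; last by move=> muk; apply: nspan; right.
  by rewrite ltnNge; apply/negP => lekm; apply: nspan; left.
move=> bad; apply: mk.
apply: (@in_span_lforms _ _ _ _ k) => [i /andP[ltmi ltik]|i].
  (* Some i with m < i < k exists here, so k > m and k must be the exceptional index; then i is not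
     exceptional and its form is memorized. *)
  have muk : mu = k.+1%:R * lambda.
    by case: bad => // lekm; move: (leq_trans ltik lekm); rewrite ltnNge ltnW.
  have mui : mu <> i.+1%:R * lambda.
    move=> /(natr_exceptional ch0 nz muk) [ki].
    by rewrite ki ltnn in ltik.
  by split; [apply: lead|apply/mem_memorized_before; split=> //; apply: mem].
have [ltmi /=|/= lemi _] := ltnP m i; last by rewrite lform_coef0 // lemi.
rewrite leq_eqVlt => /orP[/eqP ki|ltki]; last by rewrite lform_coef0 // ltki orbT.
rewrite -ki in ltmi *; case: bad => [|muk]; first by rewrite leqNgt ltmi.
by rewrite lform_coef // -muk subrr mulr0.
Qed.

(** At index m+1 only j = 0 satisfies [m < k - j], so the form there is a multiple of x_0. *)
Lemma memorized_coef0 lambda mu x :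
  memorized m lambda mu x m.+1 -> x 0%N != 0.
Proof.
apply: contra_notN => /eqP x0; rewrite (_ : lform _ _ _ _ _ = 0).
  exact: in_span0.
rewrite /lform big_ord_recl x0 scale0r add0r big1 // => j _.
by rewrite /wform lift0 subSS ltnNge leq_subr scaler0.
Qed.

(** Once x_0 is nonzero, the memorized indices do not depend on x, so the recursive choice can be
    written in closed form, with 1 as the arbitrary nonzero value. *)
Lemma exists_basic lambda mu : [pchar f] =i pred0 ->
  (lambda != 0) || (mu != 0) ->
  exists2 b, basic_normal_form m lambda mu b & b 0%N != 0.
Proof.
move=> ch0 nz.
pose b : fps f := fun k =>
  if `[< (m < k)%N /\ mu <> k.+1%:R * lambda >] then 0 else 1.
have b0 : b 0%N != 0 by rewrite /b; case: asboolP => [[]|] //; rewrite oner_neq0.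
exists b => //; split=> // k _; rewrite (memorizedP k ch0 nz b0) /b.
by case: asboolP; rewrite ?oner_eq0.
Qed.

Lemma general_normal_formP lambda mu x : [pchar f] =i pred0 ->
  (lambda != 0) || (mu != 0) -> x 0%N != 0 ->
  general_normal_form m lambda mu x <-> normal_form m lambda mu x.
Proof.
move=> ch0 nz x0; split=> [[]//|xN]; split=> //.
have [b bP b0] := exists_basic ch0 nz; exists b => // k.
by rewrite !memorizedP.
Qed.

(** When m+1 is not exceptional, a basic normal form memorizes at m+1, hence so does x. *)
Lemma general_coef0 lambda mu x : [pchar f] =i pred0 ->
  (lambda != 0) || (mu != 0) -> mu <> m.+2%:R * lambda ->
  general_normal_form m lambda mu x -> x 0%N != 0.
Proof.
move=> ch0 nz mum [_ [b [b0 _] mem]]; apply: (@memorized_coef0 lambda mu).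
by apply/mem/memorizedP.
Qed.

End Memorized.

(** * Explicit normal forms and the classification *)

Lemma sum_basis_coef (f : fieldType) n (c : nat -> f) k :
  (\sum_(i < n) c i *: basis_e i) k = if (k < n)%N then c k else 0.
Proof.
rewrite fps_coef_sum.
under eq_bigr => i _ do rewrite fps_coefZ /basis_e fps_coefXn mulr_natr mulrb.
rewrite -big_mkcond; case: ltnP => [ltkn|lenk].
  by rewrite (big_pred1 (Ordinal ltkn)) // => i; rewrite eq_sym -val_eqE.
by rewrite big1 // => i /eqP ki; move: lenk; rewrite ki leqNgt ltn_ord.
Qed.

Lemma neq0_incl (f : fieldType) (x : fps f) :
  x <> 0 -> exists n (y : fps f), y 0%N != 0 /\ x = incl n y.
Proof.
move=> xn0; have ex : exists n, x n != 0.
  apply: contra_notP xn0 => /forallNP H; apply/funext => n.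
  by apply/eqP; apply: contra_notT (H n).
have [n xn minn] := ex_minnP ex.
exists n, (fun k => x (n + k)%N); split; first by rewrite addn0.
apply: fps_XnE => i ltin; apply/eqP; apply: contraTT ltin => /minn.
by rewrite -leqNgt.
Qed.

Theorem theorem6 (f : fieldType) (charf0 : [pchar f] =i pred0)
    (lambda mu : f) (m : nat) :
  (* (1) *)
  ((forall k : nat, (0 < k)%N -> mu <> (m + k + 1)%:R * lambda) ->
   forall x : fps f,
     general_normal_form m lambda mu x <->
     exists c : nat -> f,
       c 0%N != 0 /\ x = \sum_(i < m.+1) c i *: basis_e i)
  /\
  (* (2) *)
  (forall k : nat, lambda <> 0 -> (0 < k)%N -> mu = (m + k + 1)%:R * lambda ->
   forall x : fps f, (k = 1%N -> x 0%N != 0) ->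
     (general_normal_form m lambda mu x <->
      exists c : nat -> f,
        c 0%N != 0 /\
        x = \sum_(i < m.+1) c i *: basis_e i + c (m + k)%N *: basis_e (m + k)))
  /\
  (* (3) *)
  (forall x : fps f, general_normal_form m lambda mu x ->
   forall n : nat, normal_form m lambda (mu - n%:R) (incl n x))
  /\
  (* (4), every normal form is listed *)
  (forall x : fps f, normal_form m lambda mu x -> x <> 0 ->
     (exists (n : nat) (z : fps f),
        general_normal_form m lambda (mu + n%:R) z /\ x = incl n z)
     \/
     (lambda = 0 /\
      exists p : nat, mu = - p%:R /\
      exists c : f, c != 0 /\
        (x = c *: basis_e p \/
         exists (n : nat) (C : fps f),
           [/\ (0 < n)%N, general_normal_form m 0 n%:R C
             & x = c *: basis_e p + incl (p + n) C])))
  /\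
  (* (4), the additional normal forms are normal forms *)
  (forall p : nat, lambda = 0 -> mu = - p%:R ->
   forall (c : f) (n : nat) (C : fps f),
     c != 0 -> (0 < n)%N -> general_normal_form m 0 n%:R C ->
     normal_form m lambda mu (c *: basis_e p + incl (p + n) C)).
Proof.
have inclE p c (y : fps f) : c *: basis_e p + incl p y = incl p (c *: 1 + y).
  by rewrite /incl mulrDr -scalerAr mulr1.
have incl_add p n (y : fps f) : incl (p + n) y = incl p (incl n y).
  by rewrite /incl exprD mulrA.
split; [|split; [|split; [|split]]].
- move=> mu_ne x.
  have nz : (lambda != 0) || (mu != 0).
    (* If lambda = 0, the hypothesis at k = 1 reads mu <> 0. *)
    apply/orP; have [l0|] := eqVneq lambda 0; last by left.
    by right; apply/eqP; have := mu_ne 1%N isT; rewrite l0 mulr0.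
  have mu_ne' k : (m < k)%N -> mu <> k.+1%:R * lambda.
    move=> ltmk; have := mu_ne (k - m)%N; rewrite subn_gt0 subnKC ?addn1 //.
      exact.
    exact: ltnW.
  split=> [xG|[c [c0 xE]]].
    have x0 := general_coef0 charf0 nz (mu_ne' _ (ltnSn m)) xG.
    exists x; split=> //; apply/funext => k; rewrite sum_basis_coef.
    case: ltnP => // ltmk; case: xG => xN _.
    exact: (iffLR (normal_formP m charf0 nz x0) xN k ltmk (mu_ne' k ltmk)).
  have x0 : x 0%N != 0 by rewrite xE sum_basis_coef.
  apply/general_normal_formP/normal_formP => // k ltmk _.
  by rewrite xE sum_basis_coef ltnNge ltmk.
- move=> k /eqP l0 k0 muE x xk0.
  have nz : (lambda != 0) || (mu != 0) by rewrite l0.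
  rewrite addn1 in muE.
  have mu_ne j : (mu <> j.+1%:R * lambda) <-> j != (m + k)%N.
    split=> [muj|/eqP jmk muj]; last first.
      by have [/esym] := natr_exceptional charf0 nz muE muj.
    by apply/eqP => jmk; apply: muj; rewrite jmk.
  split=> [xG|[c [c0 xE]]].
    have x0 : x 0%N != 0.
      (* For k = 1 the exceptional index is m+1 itself, so memorization there says nothing about x_0
         and the hypothesis [xk0] supplies it. *)
      have [k1|k1] := eqVneq k 1%N; first exact: xk0.
      apply: (general_coef0 charf0 nz _ xG); apply/mu_ne.
      by rewrite -addn1 eqn_add2l eq_sym.
    exists x; split=> //; apply/funext => j.
    rewrite fps_coefD sum_basis_coef fps_coefZ /basis_e fps_coefXn.
    case: ltnP => [ltjm|ltmj].
      rewrite ltn_eqF ?mulr0 ?addr0 // (leq_trans ltjm) //.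
      by rewrite -addn1 leq_add2l.
    have [->|/mu_ne muj] := eqVneq j (m + k)%N; first by rewrite mulr1 add0r.
    rewrite mulr0 addr0; case: xG => xN _.
    exact: (iffLR (normal_formP m charf0 nz x0) xN j ltmj muj).
  have mk0 : (0 < m + k)%N by rewrite addn_gt0 k0 orbT.
  have xE' j : x j = (if (j < m.+1)%N then c j else 0) +
                     c (m + k)%N * (j == m + k)%N%:R.
    by rewrite xE fps_coefD sum_basis_coef fps_coefZ /basis_e fps_coefXn.
  have x0 : x 0%N != 0 by rewrite xE' /= ltn_eqF // mulr0 addr0.
  apply/general_normal_formP/normal_formP => // j ltmj /mu_ne /negPf jmk.
  by rewrite xE' jmk mulr0 addr0 ltnNge ltmj.
- move=> x [xN _] n; apply/normal_form_incl => //.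
  by rewrite subrK.
- move=> x xN /neq0_incl [p [z [z0 xE]]].
  have zN : normal_form m lambda (mu + p%:R) z.
    by apply/normal_form_incl; rewrite -?xE.
  (* Here p is the order of x, and z has nonzero constant term in [F_{lambda,mu+p}]. *)
  have [nz|] := boolP ((lambda != 0) || (mu + p%:R != 0)).
    by left; exists p, z; split=> //; apply/general_normal_formP.
  rewrite negb_or !negbK addr_eq0 => /andP[/eqP l0 /eqP muE]; right; split=> //.
  exists p; split=> //; exists (z 0%N); split=> //.
  (* Now z lies in [F_{00}]: its constant term splits off, and the rest D is again a normal form, of
     positive order n if nonzero. *)
  pose D := z - z 0%N *: 1.
  have zE : z = z 0%N *: 1 + D by rewrite addrC subrK.
  have D0 : D 0%N = 0 by rewrite /D fps_coefD fps_coefN fps_coefZ mulr1 subrr.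
  have DN : normal_form m 0 0 D.
    by rewrite -(normal_form_addC m z0 D0) -zE; move: zN; rewrite l0 muE addNr.
  have [D_0|/neq0_incl [n [C [C0 DE]]]] := pselect (D = 0).
    by left; rewrite xE zE D_0 addr0 /incl -scalerAr mulr1 fps_coefZ mulr1.
  right; exists n, C.
  have n0 : (0 < n)%N.
    by case: n DE => // DE; rewrite -D0 DE /incl mul1r eqxx in C0.
  split=> //; last by rewrite incl_add inclE -DE -zE.
  apply/general_normal_formP => //.
    by rewrite (pcharf0P _).1 // -lt0n n0 orbT.
  by rewrite -[n%:R]add0r -normal_form_incl // -DE.
move=> p -> -> c n C c0 n0 [CN _]; rewrite incl_add inclE.
apply/normal_form_incl => //; rewrite addNr normal_form_addC ?incl_coef_lt //.
by apply/normal_form_incl; rewrite ?add0r.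
Qed.
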